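(* Let $m_1,\dots,m_N$ be given positive real numbers, and let $n=m_1+\cdots+m_N$. There are nonzero polynomials $Q_1,\dots,Q_l$ in $N-1$ variables, which do not depend on $r_1,r_3,\dots,r_N,\sigma_1,\dots,\sigma_{N-1}$, with the following property: there are complex numbers $r_1,r_3,\dots,r_N$ such that $(r_1,r_3,\dots,r_N,\sigma_1,\dots,\sigma_{N-1})$ is a solution of the system $$n\,e_k(x_1,\dots,x_{N-1})=m_2\,e_k(r_1,r_3,\dots,r_N)+\sum_{j=1,\,j\ne2}^{N}m_j\,e_{k,j}(r_1,r_3,\dots,r_N),\qquad k=1,\dots,N-2,$$ $$n\,x_1x_2\cdots x_{N-1}=m_2\,r_1r_3\cdots r_N,$$ where $$x_1=(1-\sigma_1)r_1,\qquad x_2=r_3\sigma_2,\qquad x_k=(r_{k+1}-r_k)\sigma_k+r_k\quad(3\le k\le N-1),$$ if and only if $Q_1(\sigma_1,\dots,\sigma_{N-1})=\cdots=Q_l(\sigma_1,\dots,\sigma_{N-1})=0$.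
   Context: Here $\sigma_1,\dots,\sigma_{N-1}$ are complex numbers. $e_k$ denotes the $k$th elementary symmetric function of its arguments ($e_0=1$, $e_1$ = sum, and so on). For $j\ne 2$, $e_{k,j}(r_1,r_3,\dots,r_N)$ denotes the $k$th elementary symmetric function of the numbers obtained from $r_1,r_3,\dots,r_N$ by removing $r_j$. The index $2$ is absent from the list $r_1,r_3,\dots,r_N$ because the normalization $r_2=0$ is used. The system expresses the relation between the roots $r_k$ and the ratios $\sigma_k=\frac{x_k-r_k}{r_{k+1}-r_k}$ of $p(x)=(x-r_1)^{m_1}\cdots(x-r_N)^{m_N}$, where $x_k$ is the critical point of $p$ in $(r_k,r_{k+1})$ when the $r_k$ are real and increasing.
   Formalization: The numbers r_1, r_3, ..., r_N are required to be not all zero, since r = 0 solves the system for every σ and no nonzero polynomials could then characterize solvability; also l ≥ 1 and N ≥ 2 are made explicit. *)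

(* Defs.v *)
(* [R : realType] is the field of real numbers, [R[i]] its
   complex numbers.

   Conventions.  The number of roots is N = M.+2 (so N >= 2, as r_2 must
   exist), and everything is indexed from 0: m_k is [m (k-1)], sigma_k is
   [sigma (k-1)] and x_k is the (k-1)-th critical point.  The unknowns
   r_1, r_3, ..., r_N form a family [u : 'I_M.+1 -> R[i]], i.e. all the roots
   except r_2 = 0: [u 0] is r_1 and, for i > 0, [u i] is r_{i+2}. *)
From mathcomp Require Import all_boot all_order all_algebra.
From mathcomp Require Import reals complex mpoly.

Set Implicit Arguments.
Unset Strict Implicit.
Unset Printing Implicit Defensive.

Import Order.TTheory GRing.Theory Num.Theory.
Local Open Scope ring_scope.
Local Open Scope complex_scope.

Section RatioSystem.
Variables (R : realType) (M : nat).

Definition elem_sym (d k : nat) (v : 'I_d -> R[i]) : R[i] := (mesym d R[i] k).@[v].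

(* the 0-based index of r_2 and m_2 *)
Definition second : 'I_M.+2 := lift ord0 ord0.

(* r_1, 0, r_3, ..., r_N *)
Definition all_roots (u : 'I_M.+1 -> R[i]) (j : 'I_M.+2) : R[i] :=
  if unlift second j is Some i then u i else 0.

(* The indices [widen_ord _ k] and [lift ord0 k] have values k and k + 1.  The
   three cases are x_1, x_2 and x_k for k >= 3. *)
Definition crit_point (u sigma : 'I_M.+1 -> R[i]) (k : 'I_M.+1) : R[i] :=
  let r := all_roots u (widen_ord (leqnSn M.+1) k) in
  let r_next := all_roots u (lift ord0 k) in
  match val k with
  | 0 => (1 - sigma k) * r
  | 1 => r_next * sigma k
  | _ => (r_next - r) * sigma k + r
  end.

(* [u \o lift i] is the list r_1, r_3, ..., r_N with its i-th entry removed;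
   that entry is the root r_j whose 0-based index among all the roots is
   [lift second i], so [m (lift second i)] is its multiplicity m_j. *)
Definition ratio_system (m : 'I_M.+2 -> R) (u sigma : 'I_M.+1 -> R[i]) : Prop :=
  let n : R[i] := (\sum_j m j)%:C in
  let x := crit_point u sigma in
  (forall k : nat, (1 <= k <= M)%N ->
     n * elem_sym k x =
       (m second)%:C * elem_sym k u
       + \sum_(i < M.+1) (m (lift second i))%:C * elem_sym k (u \o lift i))
  /\ n * \prod_(k < M.+1) x k = (m second)%:C * \prod_(i < M.+1) u i.

(* The k-th equation is homogeneous of degree k in the roots, so all the roots
   being 0 satisfies the system whatever sigma is.  As always for resultant
   systems of homogeneous equations, a solution therefore means a nontrivial
   one; otherwise no nonzero polynomial in sigma could be a condition. *)
Definition solvable_ratios (m : 'I_M.+2 -> R) (sigma : 'I_M.+1 -> R[i]) : Prop :=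
  exists u : 'I_M.+1 -> R[i], (exists i, u i != 0) /\ ratio_system m u sigma.

End RatioSystem.

(* Main.v *)
Require Import Defs.
From mathcomp Require Import all_boot all_order all_algebra.
From mathcomp Require Import perm boolp reals complex mpoly.

(** For fixed ratios sigma the k-th equation of the system is homogeneous of
    degree k in the unknown roots, with coefficients polynomial in sigma.  Two
    facts then give the result.

    Elimination.  Over an algebraically closed field, the parameters for which
    a family of forms has a nontrivial common zero are the common zeros of
    finitely many polynomials in the parameters ([nontrivial_zero_closed]; this
    is the closedness of the projection from a projective space times the
    parameter space).  The proof is by induction on the number of unknowns and
    projects from the point P = (0, ..., 0, 1).  The forms, read as polynomials
    p_i in the last unknown, have formal degrees d_i and leading coefficients
    that depend on sigma alone.  If all of these vanish, P is a common zero.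
    If one does not, every nontrivial common zero projects to a nontrivial
    point u' of the space with one unknown less, and u' lifts if and only if
    the p_i have a common root there.  By a generalized Sylvester criterion
    ([sylvester_minor_root], [sylvester_minor_neq0]), this happens if and only
    if the maximal minors of the matrix of all products p_i X^k of degree less
    than T = 2 max d_i vanish.  Those minors are forms in u' ([form_det]), so
    the induction hypothesis applies to them.

    Properness.  The polynomials so obtained must not all be zero, that is,
    some sigma must admit only the trivial solution.  The point sigma = 0 does:
    there x_k = r_k for all k < N, and the system reads
      n / (X - r_N) = sum_j m_j / (X - r_j).
    The residue of the right-hand side at each root is a nonempty sum of
    positive multiplicities, so every root is equal to r_N, hence to r_2 = 0
    ([weighted_critical_points], [solvable_ratios0]).  Discarding the zero
    polynomials leaves a nonempty family. *)

Set Implicit Arguments.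
Unset Strict Implicit.
Unset Printing Implicit Defensive.

Import Order.TTheory GRing.Theory Num.Theory.
Local Open Scope ring_scope.
Local Open Scope complex_scope.

(** * Zariski closed sets of parameters *)

Section Closed.
Variables (K : fieldType) (s : nat).
Implicit Types Z : ('I_s -> K) -> Prop.

Definition closed_set Z :=
  exists Qs : seq {mpoly K[s]},
    forall sigma, Z sigma <-> {in Qs, forall Q, Q.@[sigma] = 0}.

Lemma closed_setU Z1 Z2 :
  closed_set Z1 -> closed_set Z2 -> closed_set (fun sigma => Z1 sigma \/ Z2 sigma).
Proof.
move=> [Qs1 Z1E] [Qs2 Z2E]; exists [seq Q1 * Q2 | Q1 <- Qs1, Q2 <- Qs2] => sigma.
split=> [|vanish].
  move=> Zs _ /allpairsP[[Q1 Q2] /= [in1 in2 ->]]; rewrite mevalM.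
  by case: Zs => [/Z1E/(_ _ in1)|/Z2E/(_ _ in2)] ->; rewrite ?mul0r ?mulr0.
have [/allP zero1|/allPn[Q1 in1 nz1]] := boolP (all (fun Q => Q.@[sigma] == 0) Qs1).
  by left; apply/Z1E => Q /zero1/eqP.
right; apply/Z2E => Q2 in2; apply/eqP.
have/eqP := vanish _ (allpairs_f *%R in1 in2).
by rewrite mevalM mulf_eq0 (negPf nz1).
Qed.

End Closed.

(** * Forms whose coefficients are polynomials in parameters *)

Section Forms.
Variables (K : fieldType) (s : nat).
Notation family := (('I_s -> K) -> (nat -> K) -> K).

(** Homogeneous polynomials of degree [d] in the first [n] unknowns, with
    coefficients polynomial in the parameters, seen as functions.  The unknowns
    are a sequence indexed by [nat], so that a coefficient with respect to the
    last unknown is a function of the same type as the form itself. *)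
Inductive param_form (n : nat) : nat -> family -> Prop :=
| form_coef (Q : {mpoly K[s]}) : param_form n 0 (fun sigma _ => Q.@[sigma])
| form_var i : (i < n)%N -> param_form n 1 (fun _ u => u i)
| form_zero d : param_form n d (fun _ _ => 0)
| form_add d f g : param_form n d f -> param_form n d g ->
    param_form n d (fun sigma u => f sigma u + g sigma u)
| form_mul d e f g : param_form n d f -> param_form n e g ->
    param_form n (d + e) (fun sigma u => f sigma u * g sigma u)
| form_ext d f g : param_form n d f ->
    (forall sigma u, f sigma u = g sigma u) -> param_form n d g.

Lemma form_eq0 n d f : (forall sigma u, f sigma u = 0) -> param_form n d f.
Proof. by move=> f0; apply: form_ext (form_zero n d) _ => sigma u; rewrite f0. Qed.

Lemma form_scale n d f a : param_form n d f -> param_form n d (fun sigma u => a * f sigma u).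
Proof.
move=> ff; apply: form_ext (form_mul (form_coef n a%:MP) ff) _ => sigma u.
by rewrite mevalC.
Qed.

Lemma form_opp n d f : param_form n d f -> param_form n d (fun sigma u => - f sigma u).
Proof. by move=> ff; apply: form_ext (form_scale (-1) ff) _ => sigma u; rewrite mulN1r. Qed.

Lemma form_sum n d (I : Type) (r : seq I) (P : pred I) (f : I -> family) :
  (forall i, P i -> param_form n d (f i)) ->
  param_form n d (fun sigma u => \sum_(i <- r | P i) f i sigma u).
Proof.
move=> ff; elim: r => [|i r ihr].
  by apply: form_eq0 => sigma u; rewrite big_nil.
have [Pi|nPi] := boolP (P i).
  apply: form_ext (form_add (ff i Pi) ihr) _ => sigma u.
  by rewrite big_cons Pi.
by apply: form_ext ihr _ => sigma u; rewrite big_cons (negPf nPi).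
Qed.

Lemma form_prod n (I : Type) (r : seq I) (P : pred I) (d : I -> nat) (f : I -> family) :
  (forall i, P i -> param_form n (d i) (f i)) ->
  param_form n (\sum_(i <- r | P i) d i) (fun sigma u => \prod_(i <- r | P i) f i sigma u).
Proof.
move=> ff; elim: r => [|i r ihr].
  rewrite big_nil; apply: form_ext (form_coef n 1) _ => sigma u.
  by rewrite big_nil meval1.
rewrite big_cons; have [Pi|nPi] := boolP (P i).
  apply: form_ext (form_mul (ff i Pi) ihr) _ => sigma u.
  by rewrite big_cons Pi.
by apply: form_ext ihr _ => sigma u; rewrite big_cons (negPf nPi).
Qed.

(** If the entry (a, l) is a form of degree [w a - l], each product in the
    Leibniz formula has degree [\sum_a w a - \sum_l l].  A negative [w a - l]
    forces the entry to be zero, so a product containing it is zero and the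
    truncated subtraction of [nat] does no harm. *)
Lemma form_det n T (w : 'I_T -> nat) (e : 'I_T -> 'I_T -> family) :
    (forall a l : 'I_T, (l <= w a)%N -> param_form n (w a - l) (e a l)) ->
    (forall a l : 'I_T, (w a < l)%N -> forall sigma u, e a l sigma u = 0) ->
  param_form n (\sum_a w a - \sum_(l < T) l)
    (fun sigma u => \det (\matrix_(a, l) e a l sigma u)).
Proof.
move=> e_form e_zero; apply: form_sum => t _; apply: form_scale.
have [/forallP le_tw|] := boolP [forall a, t a <= w a]%N.
  have -> : (\sum_a w a - \sum_(l < T) l = \sum_a (w a - t a))%N.
    by rewrite sumnB // [X in (_ - X)%N](reindex_inj (@perm_inj _ t)).
  have/form_prod := fun a (_ : true) => e_form a (t a) (le_tw a).
  move=> /(_ (index_enum _)) ff; apply: form_ext ff _ => sigma u.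
  by apply: eq_bigr => a _; rewrite mxE.
rewrite negb_forall => /existsP[a]; rewrite -ltnNge => lt_wt.
apply: form_eq0 => sigma u.
by rewrite (bigD1 a) //= mxE e_zero // mul0r.
Qed.

Lemma form_degree0 n f :
  param_form n 0 f -> exists Q : {mpoly K[s]}, forall sigma u, f sigma u = Q.@[sigma].
Proof.
move En: {1}0%N => d ff; elim: ff En => {d f}.
- by move=> Q _; exists Q.
- by [].
- by move=> d _; exists 0 => sigma u; rewrite meval0.
- move=> d f g _ ihf _ ihg /[dup] /ihf[P fE] /ihg[Q gE].
  by exists (P + Q) => sigma u; rewrite mevalD fE gE.
- move=> d e f g _ ihf _ ihg /esym/eqP; rewrite addn_eq0 => /andP[/eqP d0 /eqP e0].
  have [P fE] := ihf (esym d0); have [Q gE] := ihg (esym e0).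
  by exists (P * Q) => sigma u; rewrite mevalM fE gE.
- by move=> d f g _ ihf fg /ihf[P fE]; exists P => sigma u; rewrite -fg.
Qed.

(** This prepares the elimination of the last unknown.  The coefficient with
    [k = d] has degree zero, so by [form_degree0] it is a polynomial in the
    parameters alone. *)
Lemma form_last_var n d f : param_form n.+1 d f ->
  exists2 c : nat -> family,
    forall k, (k <= d)%N -> param_form n (d - k) (c k) &
    forall sigma u, f sigma u = (\poly_(k < d.+1) c k sigma u).[u n].
Proof.
elim=> {d f}.
- move=> Q; exists (fun _ sigma _ => Q.@[sigma]).
    by move=> k; rewrite leqn0 => /eqP->; apply: form_coef.
  by move=> sigma u; rewrite horner_poly big_ord1 expr0 mulr1.
- move=> i; rewrite ltnS leq_eqVlt => /predU1P[->|lt_in].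
    exists (fun k _ _ => (k == 1)%:R) => [[|[|//]] _|sigma u].
    + exact: form_zero.
    + by apply: form_ext (form_coef n 1) _ => sigma u; rewrite meval1.
    by rewrite horner_poly !big_ord_recr big_ord0 /= mul0r !add0r mul1r.
  exists (fun k _ u => if k == 0 then u i else 0) => [[|[|//]] _|sigma u].
  + exact: form_var.
  + exact: form_zero.
  by rewrite horner_poly !big_ord_recr big_ord0 /= mul0r addr0 add0r mulr1.
- move=> d; exists (fun _ _ _ => 0) => [k _|sigma u]; first exact: form_zero.
  by rewrite horner_poly big1 // => i _; rewrite mul0r.
- move=> d f g _ [a a_form fE] _ [b b_form gE].
  exists (fun k sigma u => a k sigma u + b k sigma u) => [k le_kd|sigma u].
    by apply: form_add; [apply: a_form | apply: b_form].
  rewrite fE gE !horner_poly -big_split; apply: eq_bigr => k _.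
  by rewrite mulrDl.
- move=> d e f g _ [a a_form fE] _ [b b_form gE].
  exists (fun k sigma u => \sum_(i < k.+1 | (i <= d)%N && (k - i <= e)%N)
    a i sigma u * b (k - i)%N sigma u) => [k le_kde|sigma u].
    apply: form_sum => i /andP[le_id le_kie].
    have -> : (d + e - k = (d - i) + (e - (k - i)))%N.
      have le_ik : (i <= k)%N by rewrite -ltnS.
      by rewrite addnBA // addnBAC // subnBA // subnK // (leq_trans le_id (leq_addr _ _)).
    exact: form_mul (a_form _ le_id) (b_form _ le_kie).
  rewrite fE gE -hornerM; congr (_.[_]); apply/polyP => k.
  rewrite coefM coef_poly; have [lt_k|ge_k] := ltnP.
    rewrite [RHS]big_mkcond; apply: eq_bigr => i _; rewrite !coef_poly !ltnS.
    by case: (i <= d)%N; case: (k - i <= e)%N; rewrite /= ?mul0r ?mulr0.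
  apply: big1 => i _; rewrite !coef_poly !ltnS.
  case: leqP => [le_id|]; last by rewrite mul0r.
  case: leqP => [le_kie|]; last by rewrite mulr0.
  have : (k <= d + e)%N by rewrite -(@subnKC i k) ?leq_add // -ltnS.
  by rewrite leqNgt ge_k.
- move=> d f g _ [a a_form fE] fg; exists a => // sigma u.
  by rewrite -fg fE.
Qed.

Lemma form_local n d f sigma u v :
  param_form n d f -> (forall i, (i < n)%N -> u i = v i) -> f sigma u = f sigma v.
Proof.
move=> ff uv; elim: ff => {d f}.
- by [].
- by move=> i /uv.
- by [].
- by move=> d f g _ -> _ ->.
- by move=> d e f g _ -> _ ->.
- by move=> d f g _ fuv fg; rewrite -!fg.
Qed.

Lemma form_vanish n d f sigma u :
  param_form n d f -> (forall i, (i < n)%N -> u i = 0) -> (0 < d)%N -> f sigma u = 0.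
Proof.
move=> ff u0; elim: ff => {d f}.
- by [].
- by move=> i /u0.
- by [].
- by move=> d f g _ ihf _ ihg d_gt0; rewrite ihf ?ihg ?addr0.
- move=> d e f g _ ihf _ ihg; rewrite addn_gt0 => /orP[/ihf->|/ihg->].
    by rewrite mul0r.
  by rewrite mulr0.
- by move=> d f g _ fuv fg d_gt0; rewrite -!fg fuv.
Qed.

End Forms.

(** * Common roots of several polynomials in one variable *)

Section CommonRoot.
Variables (K : closedFieldType) (I : finType).
Implicit Types (p : I -> {poly K}) (d : I -> nat).

(** A common divisor of the [p i] that is a combination of them has no root,
    hence is a nonzero constant over an algebraically closed field. *)
Lemma bezout_no_common_root p :
  ~ (exists x, forall i, (p i).[x] = 0) ->
  exists b : I -> {poly K}, \sum_i b i * p i = 1.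
Proof.
move=> no_root.
have gcd_comb (r : seq I) : exists2 g, forall i, i \in r -> g %| p i &
    exists b : I -> {poly K}, g = \sum_i b i * p i.
  elim: r => [|j r [g g_div [b gE]]].
    by exists 0 => //; exists (fun=> 0); rewrite big1 // => i _; rewrite mul0r.
  have [[u v] /= /andP[uv_gcd _]] := Bezoutp (p j) g.
  exists (u * p j + v * g).
    move=> i; rewrite inE => /predU1P[->|/g_div].
      exact: dvdp_trans uv_gcd (dvdp_gcdl _ _).
    exact/dvdp_trans/(dvdp_trans uv_gcd)/dvdp_gcdr.
  exists (fun i => (if i == j then u else 0) + v * b i).
  under eq_bigr do rewrite mulrDl -mulrA.
  rewrite big_split -mulr_sumr -gE (bigD1 j) //= eqxx big1 ?addr0 // => i /negPf->.
  by rewrite mul0r.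
have [g g_div [b gE]] := gcd_comb (index_enum I).
have : size g == 1%N.
  apply: contraT => /closed_rootP[x g0]; case: no_root; exists x => i.
  apply/rootP; move: g0; rewrite -!dvdp_XsubCl => /dvdp_trans-> //.
  exact/g_div/mem_index_enum.
move=> /size_poly1P[c nz_c gc]; exists (fun i => c^-1%:P * b i).
under eq_bigr do rewrite -mulrA.
by rewrite -mulr_sumr -gE gc -polyCM mulVf.
Qed.

(** The rows of the generalized Sylvester matrix are the products [p i * 'X^k]
    of formal degree less than [T].  The other pairs [(i, k)] get a zero row, so
    that all rows are indexed by one product type. *)
Definition sylvester_row d T p (e : I * 'I_T) : {poly K} :=
  if (d e.1 + e.2 < T)%N then p e.1 * 'X^(e.2) else 0.

Definition sylvester_minor d T p (g : 'I_T -> I * 'I_T) : K :=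
  \det (\matrix_(a, l < T) (sylvester_row d p (g a))`_l).

Lemma sylvester_row_root d T p e x : (forall i, (p i).[x] = 0) ->
  (@sylvester_row d T p e).[x] = 0.
Proof.
move=> root_x; rewrite /sylvester_row; case: ifP => _; last by rewrite horner0.
by rewrite hornerM root_x mul0r.
Qed.

Lemma size_sylvester_row d T p e : (forall i, size (p i) <= (d i).+1)%N ->
  (size (@sylvester_row d T p e) <= T)%N.
Proof.
move=> le_p; rewrite /sylvester_row; case: ifP => [|_]; last by rewrite size_poly0.
apply: leq_trans; apply: leq_trans (size_polyMleq _ _) _.
by rewrite size_polyXn addnS /= -addSn leq_add2r.
Qed.

(** The powers of a common root form a nonzero vector in the kernel of the
    Sylvester matrix. *)
Lemma sylvester_minor_root d T p g x : (0 < T)%N ->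
    (forall i, size (p i) <= (d i).+1)%N -> (forall i, (p i).[x] = 0) ->
  @sylvester_minor d T p g = 0.
Proof.
move=> T_gt0 le_p root_x; rewrite /sylvester_minor -det_tr; apply/eqP/det0P.
exists (\row_(l < T) x ^+ l).
  apply/eqP => /rowP/(_ (Ordinal T_gt0)); rewrite !mxE expr0 => /eqP.
  by rewrite oner_eq0.
apply/rowP => a; rewrite !mxE -[RHS](sylvester_row_root d (g a) root_x).
rewrite (horner_coef_wide _ (size_sylvester_row _ le_p)).
by apply: eq_bigr => l _; rewrite !mxE mulrC.
Qed.

(** Without common root, every [q] of degree less than [T] is a combination of
    the [p i], by Bezout.  Division by [p i0], whose degree is exactly [d i0],
    reduces each coefficient to degree less than [d i0], the quotients being
    absorbed by the coefficient of [p i0]; the degree bounds then show that only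
    rows of the Sylvester matrix occur.  So its rank is [T]. *)
Lemma sylvester_minor_neq0 d T p i0 :
    (forall i, size (p i) <= (d i).+1)%N -> size (p i0) = (d i0).+1 ->
    (forall i, d i0 + d i <= T)%N -> ~ (exists x, forall i, (p i).[x] = 0) ->
  exists g : {ffun 'I_T -> I * 'I_T}, sylvester_minor d p g != 0.
Proof.
move=> le_p size_p0 le_T /bezout_no_common_root[b bp1].
pose A := \matrix_(e < #|{: I * 'I_T}|) (poly_rV (sylvester_row d p (enum_val e)) : 'rV_T).
have row_A i (c : {poly K}) : (d i + size c <= T)%N -> (poly_rV (c * p i) <= A)%MS.
  move=> le_cT; rewrite -[c]coefK poly_def mulr_suml linear_sum summx_sub // => k _.
  have lt_kT : (k < T)%N by apply: leq_trans le_cT; rewrite ltn_addl.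
  rewrite -scalerAl linearZ scalemx_sub //=.
  rewrite (_ : poly_rV _ = row (enum_rank (i, Ordinal lt_kT)) A) ?row_sub //.
  rewrite rowK enum_rankK /sylvester_row /= mulrC ifT //.
  by apply: leq_trans le_cT; rewrite ltn_add2l.
have full_A : row_full A.
  rewrite -sub1mx; apply/row_subP => l; move: (row l _) => v.
  have {v} [q le_q ->] : exists2 q : {poly K}, (size q <= T)%N & v = poly_rV q.
    by exists (rVpoly v); rewrite ?size_poly // rVpolyK.
  pose a := \sum_i (q * b i) %/ p i0 * p i.
  pose c i := (q * b i) %% p i0.
  have nz_p0 : p i0 != 0 by rewrite -size_poly_gt0 size_p0.
  have size_c i : (size (c i) <= d i0)%N.
    by rewrite -ltnS -size_p0 ltn_modp.
  have qE : q = a * p i0 + \sum_i c i * p i.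
    rewrite mulr_suml -big_split -[LHS]mulr1 -bp1 mulr_sumr; apply: eq_bigr => i _ /=.
    by rewrite mulrA {1}(divp_eq (q * b i) (p i0)) mulrDl -!mulrA [p i0 * _]mulrC.
  have sub_c : (poly_rV (\sum_i c i * p i) <= A)%MS.
    rewrite linear_sum summx_sub // => i _; apply: row_A.
    by rewrite addnC (leq_trans (leq_add (size_c i) (leqnn _))).
  rewrite qE linearD addmx_sub //; apply: row_A.
  have [->|nz_a] := eqVneq a 0; first by rewrite size_poly0 addn0 (leq_trans _ (le_T i0)) ?leq_addr.
  have : (size (a * p i0)%R <= T)%N.
    rewrite (_ : a * p i0 = q - \sum_i c i * p i); last by rewrite {1}qE addrK.
    rewrite (leq_trans (size_polyD _ _)) // geq_max le_q size_polyN /=.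
    rewrite (leq_trans (size_sum _ _ _)) //; apply/bigmax_leqP => i _.
    rewrite (leq_trans (size_polyMleq _ _)) // (leq_trans _ (le_T i)) // -ltnS.
    have := leq_add (size_c i) (le_p i); rewrite addnS; case: (_ + _)%N => //.
  by rewrite size_mul // size_p0 addnS addnC.
exists [ffun a => enum_val (fullrankfun full_A a)].
have := fullrowsub_unit full_A; rewrite unitmxE unitfE; rewrite /sylvester_minor.
set D := (X in \det X); set E := (X in _ -> \det X != 0).
suff -> : E = D by [].
by apply/matrixP => a l; rewrite !mxE ffunE.
Qed.

End CommonRoot.

(** * Elimination of the unknowns *)

Section Projection.
Variables (K : closedFieldType) (s : nat).
Notation family := (('I_s -> K) -> (nat -> K) -> K).

Definition nontrivial_zero n (I : finType) (f : I -> family) (sigma : 'I_s -> K) :=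
  exists u : nat -> K,
    (exists2 i, (i < n)%N & u i != 0) /\ forall i, f i sigma u = 0.

Definition set_last n (u : nat -> K) x i := if i == n then x else u i.

(** The main theorem of elimination theory.  In the induction step the closed
    set is a union of two: the parameters for which all leading coefficients
    vanish, so that the center of projection is a common zero, and those for
    which the Sylvester minors have a nontrivial common zero. *)
Theorem nontrivial_zero_closed n (I : finType) (d : I -> nat) (f : I -> family) :
  (forall i, param_form n (d i) (f i)) -> closed_set (nontrivial_zero n f).
Proof.
elim: n I d f => [|n ih] I d f f_form.
  exists [:: 1] => sigma; split=> [[u [[]]] //|].
  by move/(_ 1 (mem_head _ _)) => /eqP; rewrite meval1 oner_eq0.
(* The forms as polynomials [p sigma u i] in the last unknown. *)
have /fin_all_exists2[c c_form fE] := fun i => form_last_var (f_form i).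
pose T := (\max_i d i).*2.
have le_dT i j : (d i + d j <= T)%N by rewrite /T -addnn leq_add ?leq_bigmax.
pose p sigma u i := \poly_(k < (d i).+1) c i k sigma u.
have le_p sigma u i : (size (p sigma u i) <= (d i).+1)%N by apply: size_poly.
pose minors (g : {ffun 'I_T -> I * 'I_T}) sigma u := sylvester_minor d (p sigma u) g.
have minors_form (g : {ffun 'I_T -> I * 'I_T}) :
    param_form n (\sum_a (d (g a).1 + (g a).2) - \sum_(l < T) l) (minors g).
  apply: (form_det (w := fun a => (d (g a).1 + (g a).2)%N)
    (e := fun a l sigma u => (sylvester_row d (p sigma u) (g a))`_l)).
    move=> a l; case: (g a) => i k /= le_l.
    rewrite /sylvester_row /=; case: (d i + k < T)%N; last first.
      by apply: form_eq0 => sigma u; rewrite coef0.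
    have [lt_lk|le_kl] := ltnP l k.
      by apply: form_eq0 => sigma u; rewrite coefMXn lt_lk.
    have le_lkd : (l - k <= d i)%N by rewrite leq_subLR addnC.
    rewrite (_ : (d i + k - l)%N = (d i - (l - k))%N); last by rewrite subnBA.
    apply: form_ext (c_form i _ le_lkd) _ => sigma u.
    by rewrite coefMXn ltnNge le_kl coef_poly ltnS le_lkd.
  move=> a l lt_l sigma u; rewrite /sylvester_row; case: ifP => _; last by rewrite coef0.
  rewrite coefMXn; case: ltnP => // le_kl; rewrite coef_poly ifF // ltnS.
  by apply/negbTE; rewrite -ltnNge ltn_subRL addnC.
have lead_form i : param_form n 0 (c i (d i)) by rewrite -(subnn (d i)); apply: c_form.
have /fin_all_exists[lead leadE] := fun i => form_degree0 (lead_form i).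
(* At the center of projection only the leading terms survive. *)
have vertex sigma u i : (forall j, (j < n)%N -> u j = 0) ->
    f i sigma u = (lead i).@[sigma] * u n ^+ d i.
  move=> u0; rewrite fE horner_poly (bigD1 ord_max) //= leadE big1 ?addr0 // => k.
  rewrite -val_eqE /= => neq_kd; rewrite (form_vanish _ (c_form i k _) u0) ?mul0r //.
    by rewrite -ltnS.
  by rewrite subn_gt0 ltn_neqAle neq_kd -ltnS ltn_ord.
have lead_closed : closed_set (fun sigma => forall i, (lead i).@[sigma] = 0).
  exists [seq lead i | i <- enum I] => sigma; split.
    by move=> lead0 _ /mapP[i _ ->].
  by move=> lead0 i; apply/lead0/map_f; rewrite mem_enum.
have [Qs QsP] := closed_setU (ih _ _ _ minors_form) lead_closed.
exists Qs => sigma; rewrite -QsP {Qs QsP}.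
have [lead0|lead0] := boolP [forall i, (lead i).@[sigma] == 0].
  split=> [_|_]; first by right => i; apply/eqP/(forallP lead0).
  exists (fun j => (j == n)%:R); split; first by exists n; rewrite // eqxx oner_eq0.
  move=> i; rewrite vertex; first by rewrite (eqP (forallP lead0 i)) mul0r.
  by move=> j lt_jn; rewrite ltn_eqF.
(* Some leading coefficient is nonzero, so the center is not a common zero. *)
move: lead0; rewrite negb_forall => /existsP[i0 nz_lead].
have size_p0 u : size (p sigma u i0) = (d i0).+1.
  by rewrite size_poly_eq // leadE.
split.
  move=> [u [[j lt_jn nz_uj] f0]]; left; exists u; split.
    have [/existsP[k nz_uk]|/existsPn all0] := boolP [exists k : 'I_n, u k != 0].
      by exists k.
    have u0 k : (k < n)%N -> u k = 0 by move=> lt_k; apply/eqP/negPn/(all0 (Ordinal lt_k)).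
    have /eqP := f0 i0; rewrite vertex // mulf_eq0 (negPf nz_lead) expf_eq0.
    move: lt_jn nz_uj; rewrite ltnS leq_eqVlt => /predU1P[->|/u0->]; last by rewrite eqxx.
    by move=> /negPf->; rewrite andbF.
  (* If [T = 0], then [p sigma u i0] is a nonzero constant without root. *)
  move=> g; have [T_gt0|] := ltnP 0 T; last rewrite leqn0 => /eqP T0.
    by apply: (@sylvester_minor_root _ _ _ _ _ _ (u n)) => // i; rewrite -fE.
  have := le_dT i0 i0; rewrite T0 leqn0 addn_eq0 => /andP[/eqP d0 _].
  have := f0 i0; rewrite fE horner_poly d0 big_ord1 mulr1 => c0.
  by case/eqP: nz_lead; rewrite -(leadE i0 sigma u) d0.
case=> [[u [[j lt_jn nz_uj] minors0]]|lead0]; last by rewrite lead0 eqxx in nz_lead.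
have [x root_x] : exists x, forall i, (p sigma u i).[x] = 0.
  have [//|no_root] := pselect (exists x, forall i, (p sigma u i).[x] = 0).
  have [g /eqP[]] := sylvester_minor_neq0 (le_p sigma u) (size_p0 u) (le_dT i0) no_root.
  exact: minors0.
exists (set_last n u x); split.
  by exists j; rewrite ?ltnS ?(ltnW lt_jn) // /set_last ltn_eqF.
move=> i; rewrite fE /set_last eqxx -[RHS](root_x i); congr (_.[x]).
apply: eq_poly => k lt_k; apply: form_local (c_form i k lt_k) _ => l lt_ln.
by rewrite ltn_eqF.
Qed.

End Projection.

(** * Weighted critical points that are roots *)

Lemma prod_neq_lift (V : comRingType) n (h : 'I_n.+1) (F : 'I_n.+1 -> V) :
  \prod_(i | i != h) F i = \prod_(i < n) F (lift h i).
Proof.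
rewrite big_mkcond (bigD1_ord h) //= eqxx mul1r; apply: eq_bigr => i _.
by rewrite eq_sym neq_lift.
Qed.

(** In terms of rational functions the hypothesis is
    W / (X - r j0) = sum_j w j / (X - r j); taking residues at a root
    [a != r j0] shows that the weights of the roots equal to [a] sum to zero.
    The proof cancels ['X - a] one time less than its multiplicity [e.+1] in
    [\prod_i ('X - r i)] and evaluates at [a]. *)
Lemma weighted_critical_points (F : fieldType) (J : finType) (j0 : J) (r w : J -> F) W :
    (forall S : {set J}, S != set0 -> \sum_(j in S) w j != 0) ->
    W *: \prod_(k | k != j0) ('X - (r k)%:P) =
      \sum_j w j *: \prod_(i | i != j) ('X - (r i)%:P) ->
  forall j, r j = r j0.
Proof.
move=> w_neq0 crit j1; apply/eqP/contraT => neq_r.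
pose a := r j1; pose S := [set j | r j == a].
pose G j := \prod_(i | (i != j) && (i \notin S)) ('X - (r i)%:P).
have S_j1 : j1 \in S by rewrite inE.
pose e := #|S|.-1.
have card_S : #|S| = e.+1 by rewrite prednK // card_gt0; apply/set0Pn; exists j1.
have prodE j : \prod_(i | i != j) ('X - (r i)%:P) =
    ('X - a%:P) ^+ e * (('X - a%:P) ^+ (j \notin S) * G j).
  rewrite (bigID (mem S)) /= mulrA -exprD; congr (_ * _).
  rewrite (eq_bigr (fun=> 'X - a%:P)) => [|i /andP[_]]; last first.
    by rewrite inE => /eqP->.
  rewrite prodr_const; congr (_ ^+ _).
  rewrite (eq_card (B := S :\ j)) => [|i]; last by rewrite unfold_in !inE.
  have := cardsD1 j S; rewrite card_S.
  by case: (j \in S) => /=; rewrite ?add0n ?add1n ?addn0 ?addn1; [case=> -> | move=> ->].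
move: crit; rewrite prodE.
rewrite (eq_bigr (fun j => ('X - a%:P) ^+ e * (w j *: (('X - a%:P) ^+ (j \notin S) * G j))))
  => [|j _]; last by rewrite prodE -scalerAr.
rewrite -mulr_sumr scalerAr => /(mulfI (expf_neq0 e (negbT (polyXsubC_eq0 a)))).
have at_a j : (('X - a%:P) ^+ (j \notin S) * G j).[a] = if j \in S then (G j).[a] else 0.
  case: (j \in S); first by rewrite expr0 mul1r.
  by rewrite expr1 hornerM hornerXsubC subrr mul0r.
have notin_j0 : j0 \notin S by rewrite inE eq_sym.
move=> /(congr1 (horner^~ a)); rewrite hornerZ at_a (negPf notin_j0) mulr0.
rewrite horner_sum (bigID (mem S)) /= [X in _ + X]big1 => [|j notin_j]; last first.
  by rewrite hornerZ at_a (negPf notin_j) mulr0.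
pose g := \prod_(i | i \notin S) (a - r i).
rewrite (eq_bigr (fun j => w j * g)) => [|j j_in]; last first.
  rewrite hornerZ at_a j_in horner_prod; congr (_ * _).
  apply: eq_big => [i|i _]; last by rewrite !hornerE.
  by case: eqVneq => // ->; rewrite j_in.
rewrite addr0 -mulr_suml => /esym/eqP; rewrite mulf_eq0 => /orP[|].
  by rewrite (negPf (w_neq0 _ _)) //; apply/set0Pn; exists j1.
by case/prodf_eq0 => i; rewrite inE subr_eq0 eq_sym => /negPf->.
Qed.

(** * The ratio system as a family of forms *)

Section System.
Variable R : realType.
Local Notation K := R[i].

Lemma elem_symE d k (v : 'I_d -> K) :
  elem_sym k v = \sum_(h : {set 'I_d} | #|h| == k) \prod_(i in h) v i.
Proof.
rewrite /elem_sym /mesym (big_morph _ (mevalD v) (meval0 v)); apply: eq_bigr => h _.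
by rewrite (big_morph _ (mevalM v) (meval1 v)); apply: eq_bigr => i _; rewrite /= mevalXU.
Qed.

Lemma elem_sym_all d (v : 'I_d -> K) : elem_sym d v = \prod_i v i.
Proof.
rewrite /elem_sym mesymnnE (big_morph _ (mevalM v) (meval1 v)).
by apply: eq_bigr => i _; rewrite /= mevalXU.
Qed.

Lemma elem_sym_gt d k (v : 'I_d -> K) : (d < k)%N -> elem_sym k v = 0.
Proof. by move=> lt_dk; rewrite /elem_sym mesym_geqnE ?meval0. Qed.

(** Vieta's formulas.  The factor ['X^(D - d)] makes products of different
    numbers of factors comparable: the coefficients with [k > d] are zero. *)
Lemma prod_XsubC_elem_sym d D (v : 'I_d -> K) : (d <= D)%N ->
  'X^(D - d) * \prod_(i < d) ('X - (v i)%:P) =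
  \sum_(k < D.+1) ((-1) ^+ k * elem_sym k v) *: 'X^(D - k).
Proof.
move=> le_dD; under eq_bigr do rewrite addrC -polyCN.
rewrite bigA_distr mulr_sumr /=.
have le_hd (h : {set 'I_d}) : (#|h| <= d)%N by rewrite -[leqRHS](card_ord d) max_card.
rewrite (partition_big (fun h : {set 'I_d} => inord #|h| : 'I_D.+1) predT) //=.
apply: eq_bigr => k _; rewrite elem_symE mulr_sumr scaler_suml.
apply: eq_big => [h|h /eqP <-].
  by rewrite -val_eqE /= inordK // ltnS (leq_trans (le_hd h)).
rewrite inordK ?ltnS ?(leq_trans (le_hd h)) //.
rewrite big_if -rmorph_prod prodr_const prodrN mulrCA mul_polyC -exprD; congr (_ *: 'X^_).
rewrite (_ : #|_| = d - #|h|)%N ?addnBA ?subnK //.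
by apply: (@addnI #|h|); rewrite subnKC // -[RHS](card_ord d) -(cardC (mem h)).
Qed.

Variables (M : nat) (m : 'I_M.+2 -> R).

Definition ratio_defect (k : nat) sigma (u : 'I_M.+1 -> K) : K :=
  (\sum_j m j)%:C * elem_sym k (crit_point u sigma)
  - ((m (second M))%:C * elem_sym k u
     + \sum_(i < M.+1) (m (lift (second M) i))%:C * elem_sym k (u \o lift i)).

(** The last equation of the system is the case [k = N - 1] of the others: the
    elementary symmetric function of degree N - 1 of N - 1 numbers is their
    product, and that of N - 2 numbers is zero. *)
Lemma ratio_systemE u sigma :
  ratio_system m u sigma <-> forall k : 'I_M.+1, ratio_defect k.+1 sigma u = 0.
Proof.
have top : ratio_defect M.+1 sigma u =
    (\sum_j m j)%:C * \prod_(k < M.+1) crit_point u sigma k -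
    (m (second M))%:C * \prod_(i < M.+1) u i.
  rewrite /ratio_defect !elem_sym_all [X in _ - (_ + X)]big1 ?addr0 // => i _.
  by rewrite elem_sym_gt ?mulr0.
split=> [[low last] k|defect0].
  have := ltn_ord k; rewrite ltnS leq_eqVlt => /predU1P[->|lt_kM].
    by rewrite top last subrr.
  by rewrite /ratio_defect low ?subrr.
split=> [[|k] // /andP[_ lt_kM]|].
  by apply: subr0_eq; apply: (defect0 (Ordinal (ltnW lt_kM : k < M.+1)%N)).
by apply: subr0_eq; rewrite -top (defect0 ord_max).
Qed.

Definition restrict (u : nat -> K) (i : 'I_M.+1) : K := u i.

Lemma form_elem_sym n e k (v : 'I_e -> ('I_M.+1 -> K) -> (nat -> K) -> K) :
  (forall i, param_form n 1 (v i)) ->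
  param_form n k (fun sigma u => elem_sym k (fun i => v i sigma u)).
Proof.
move=> v_form.
apply: (form_ext (f := fun sigma u =>
  \sum_(h : {set 'I_e} | #|h| == k) \prod_(i in h) v i sigma u)).
  apply: form_sum => h /eqP <-; rewrite -sum1_card.
  by apply: form_prod => i _; apply: v_form.
by move=> sigma u; rewrite elem_symE.
Qed.

Lemma form_root (j : 'I_M.+2) :
  param_form M.+1 1 (fun (sigma : 'I_M.+1 -> K) u => all_roots (restrict u) j).
Proof.
rewrite /all_roots; case: unlift => [i|]; first exact: form_var.
exact: form_eq0.
Qed.

Lemma form_mul_param n k (h : ('I_M.+1 -> K) -> (nat -> K) -> K) :
  param_form n 1 h -> param_form n 1 (fun sigma u => h sigma u * sigma k).
Proof.
move=> hf; apply: form_ext (form_mul hf (form_coef n 'X_k)) _ => sigma u.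
by rewrite mevalXU.
Qed.

Lemma form_crit_point k :
  param_form M.+1 1 (fun (sigma : 'I_M.+1 -> K) u => crit_point (restrict u) sigma k).
Proof.
rewrite /crit_point.
have rf := form_root (widen_ord (leqnSn M.+1) k).
have r'f := form_root (lift ord0 k).
case: (val k) => [|[|_]].
- apply: form_ext (form_add rf (form_opp (form_mul_param k rf))) _ => sigma u.
  by rewrite mulrBl mul1r [sigma k * _]mulrC.
- exact: form_mul_param.
- apply: form_add => //; apply: form_mul_param; apply: form_add => //.
  exact: form_opp.
Qed.

Lemma form_ratio_defect k :
  param_form M.+1 k (fun sigma (u : nat -> K) => ratio_defect k sigma (restrict u)).
Proof.
apply: form_add.
  by apply/form_scale/form_elem_sym/form_crit_point.
apply/form_opp/form_add.
  by apply/form_scale/form_elem_sym => i; apply: form_var.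
apply: form_sum => i _; apply/form_scale.
by apply: form_elem_sym => j; apply: form_var.
Qed.

Lemma solvable_ratiosE sigma :
  solvable_ratios m sigma <->
  nontrivial_zero M.+1 (fun k : 'I_M.+1 =>
    (fun sigma (u : nat -> K) => ratio_defect k.+1 sigma (restrict u))) sigma.
Proof.
split=> [[u [[i nz_ui] /ratio_systemE u_sys]]|[u [[i lt_iM nz_ui] u_sys]]].
  have uE : restrict (fun i => u (inord i)) = u.
    by apply/funext => j; rewrite /restrict inord_val.
  exists (fun i => u (inord i)); split=> [|k]; last by rewrite uE.
  by exists i; rewrite ?inord_val.
exists (restrict u); split; last first.
  by apply/ratio_systemE => k; apply: u_sys.
by exists (Ordinal lt_iM).
Qed.

(** * The point sigma = 0 *)

(** For sigma_k = 0 the critical point x_k is the left end r_k of its interval;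
    the formula for x_2, which is specialized to r_2 = 0, gives 0 as well. *)
Lemma crit_point0 (u : 'I_M.+1 -> K) k :
  crit_point u (fun=> 0) k = all_roots u (lift ord_max k).
Proof.
have -> : lift ord_max k = widen_ord (leqnSn M.+1) k by apply: val_inj; exact: lift_max.
rewrite /crit_point; case Ek: (val k) => [|[|l]].
- by rewrite subr0 mul1r.
- rewrite mulr0 /all_roots (_ : widen_ord _ k = second M) ?unlift_none //.
  exact: val_inj.
- by rewrite mulr0 add0r.
Qed.

(** Both sides are the quotient of p' by the product of the (X - r_j)^(m_j - 1),
    where p is the product of the (X - r_j)^m_j.  The system compares their
    coefficients; the leading ones agree because n is the sum of the m_j.  The
    factor ['X] coming from r_2 = 0 aligns the products over [u \o lift i],
    which have one factor less, with the others. *)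
Lemma ratio_system_polynomial (u sigma : 'I_M.+1 -> K) : ratio_system m u sigma ->
  (\sum_j m j)%:C *: \prod_(k < M.+1) ('X - (crit_point u sigma k)%:P) =
  \sum_j (m j)%:C *: \prod_(i | i != j) ('X - (all_roots u i)%:P).
Proof.
move=> /ratio_systemE defect0.
have root_lift i : all_roots u (lift (second M) i) = u i by rewrite /all_roots liftK.
have root_second : all_roots u (second M) = 0 by rewrite /all_roots unlift_none.
rewrite [RHS](bigD1_ord (second M)) //= prod_neq_lift.
under [X in _ *: X + _]eq_bigr do rewrite root_lift.
under [X in _ + X]eq_bigr => i _.
  rewrite (bigD1_ord (second M)) /=; last by rewrite neq_lift.
  under eq_bigl do rewrite (inj_eq lift_inj).
  rewrite prod_neq_lift root_second subr0.
  under eq_bigr do rewrite root_lift.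
  have := @prod_XsubC_elem_sym _ M.+1 (u \o lift i) (leqnSn M).
  rewrite subSnn expr1 => ->; rewrite scaler_sumr.
  over.
have expand v := @prod_XsubC_elem_sym _ M.+1 v (leqnn _).
rewrite subnn in expand; rewrite exchange_big /=.
have := expand (crit_point u sigma); rewrite mul1r => ->.
have := expand u; rewrite mul1r => ->.
rewrite !scaler_sumr -big_split /=; apply: eq_bigr => k _.
under [X in _ = _ + X]eq_bigr do rewrite scalerA.
rewrite -scaler_suml !scalerA -scalerDl; congr (_ *: _).
under [X in _ = _ + X]eq_bigr do rewrite mulrCA.
rewrite -mulr_sumr ![_%:C * (_ * _)]mulrCA -mulrDr; congr (_ * _).
case: k => [[|k] lt_k] /=; last by apply/subr0_eq/(defect0 (Ordinal (lt_k : k < M.+1)%N)).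
rewrite /elem_sym !mesym0E !meval1; under [X in _ = _ + X]eq_bigr do rewrite meval1 mulr1.
by rewrite !mulr1 (bigD1_ord (second M)) //= rmorphD rmorph_sum.
Qed.

(** Positivity of the multiplicities enters here: no nonempty set of them has
    sum zero. *)
Lemma solvable_ratios0 : (forall j, 0 < m j) -> ~ solvable_ratios m (fun=> 0).
Proof.
move=> m_gt0 [u [[i /eqP nz_ui] /ratio_system_polynomial]].
under [X in _ *: X = _]eq_bigr do rewrite crit_point0.
rewrite -(prod_neq_lift _ (fun k => 'X - (all_roots u k)%:P)) => crit.
have w_neq0 (S : {set 'I_M.+2}) : S != set0 -> \sum_(j in S) (m j)%:C != 0.
  move=> /set0Pn[j Sj]; rewrite -rmorph_sum fmorph_eq0 gt_eqF //.
  by rewrite (bigD1 j) //= ltr_wpDr // sumr_ge0 // => k _; apply: ltW.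
have eq_root := weighted_critical_points w_neq0 crit.
apply: nz_ui; have := eq_root (lift (second M) i); rewrite -(eq_root (second M)).
by rewrite /all_roots liftK unlift_none.
Qed.

End System.

(** * The conditions on the ratios *)

Theorem proposition12 (R : realType) (M : nat) (m : 'I_M.+2 -> R)
  (m_gt0 : forall j, 0 < m j) :
  exists (l : nat) (Q : 'I_l -> {mpoly R[i][M.+1]}),
    (0 < l)%N /\ (forall a, Q a != 0) /\
    forall sigma : 'I_M.+1 -> R[i],
      solvable_ratios m sigma <-> (forall a, (Q a).@[sigma] = 0).
Proof.
have [Qs QsP] := nontrivial_zero_closed (fun k : 'I_M.+1 => form_ratio_defect m k.+1).
pose Qs' := [seq Q <- Qs | Q != 0].
exists (size Qs'), (tnth (in_tuple Qs')).
have Qs'P sigma : solvable_ratios m sigma <-> forall a, (tnth (in_tuple Qs') a).@[sigma] = 0.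
  rewrite solvable_ratiosE QsP; split=> [zero a|zero Q inQ].
    by apply: zero; have := mem_tnth a (in_tuple Qs'); rewrite mem_filter => /andP[].
  have [->|nzQ] := eqVneq Q 0; first by rewrite meval0.
  have /tnthP[a ->] : Q \in in_tuple Qs' by rewrite mem_filter nzQ.
  exact: zero.
split; last split=> // a; last first.
  by have := mem_tnth a (in_tuple Qs'); rewrite mem_filter => /andP[].
rewrite lt0n; apply/negP => /eqP Qs'0.
apply: (solvable_ratios0 m_gt0); apply/Qs'P => -[a lt_a].
by exfalso; rewrite Qs'0 in lt_a.
Qed.
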